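(* Let $(\bar X,\Omega)$ be a weighted data set in $\mathbb{R}^d$, let $\bar C\in\mathcal{C}_\mathrm{K}(k,\bar X,\Omega)$ admit a strictly compatible anisotropic diagram, and let $L$ be a line in $\mathbb{R}^d$. Then there is a partition of $L$ into at most $2k-1$ proper intervals such that all data points in the relative interior of each interval are fully assigned to the same cluster.
   Context: Weighted data set: points $\bar x_1,\dots,\bar x_n\in\mathbb{R}^d$ with weights $\omega_j>0$. A $k$-clustering is $C=(\xi_{ij})$ with $\xi_{ij}\ge0$, $\sum_i\xi_{ij}=1$; $\mathcal{C}_\mathrm{K}(k,\bar X,\Omega)$ the set of those with $\kappa_i^-\le\sum_j\xi_{ij}\omega_j\le\kappa_i^+$ for given weight bounds. A point $\bar x_j$ is fully assigned to cluster $i$ if $\xi_{ij}=1$. Support: $\mathrm{supp}(C_i)=\{\bar x_j:\xi_{ij}>0\}$. An anisotropic diagram $\mathcal{P}(T,\Sigma,\mathcal{A})=\{P_1,\dots,P_k\}$ is given by distinct sites $t_1,\dots,t_k\in\mathbb{R}^d$, sizes $\sigma_1,\dots,\sigma_k\in\mathbb{R}$ and symmetric positive definite matrices $A_1,\dots,A_k$, with cells $P_i=\{x\in\mathbb{R}^d:\|x-t_i\|_{A_i}^2+\sigma_i\le\|x-t_\ell\|_{A_\ell}^2+\sigma_\ell\ \forall\ell\in[k]\}$, where $\|y\|_A^2=y^\top Ay$. $C$ and $\mathcal{P}$ are strongly compatible if $\mathrm{supp}(C_i)=P_i\cap\bar X$ for all $i$, and strictly compatible if they are strongly compatible and for all $i\ne\ell$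 the set $P_i\cap P_\ell\cap\bar X$ contains at most one point. A proper interval is a one-dimensional one. *)

(* Defs.v *)
From mathcomp Require Import all_boot all_order all_algebra.
From mathcomp Require Import all_classical all_reals all_analysis.

Set Implicit Arguments.
Unset Strict Implicit.
Unset Printing Implicit Defensive.

Import Order.TTheory GRing.Theory Num.Theory.
Import numFieldNormedType.Exports.

Local Open Scope classical_set_scope.
Local Open Scope ring_scope.

(* The squared norm ||y||_A^2; the product y^T A y is a 1 x 1 matrix. *)
Definition sqnorm (R : realType) (d : nat) (A : 'M[R]_d) (y : 'cV[R]_d) : R :=
  (y^T *m A *m y) 0 0.

Definition sym_posdef (R : realType) (d : nat) (A : 'M[R]_d) : Prop :=
  A^T = A /\ forall y : 'cV[R]_d, y != 0 -> 0 < sqnorm A y.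

(* [xi i j] is the fraction of point [j] that is assigned to cluster [i]. *)
Definition clustering (R : realType) (k n : nat) (xi : 'M[R]_(k, n)) : Prop :=
  (forall i j, 0 <= xi i j) /\ (forall j, \sum_i xi i j = 1).

(* The set C_K(k, X, Omega); it depends only on the weights of the data. *)
Definition constrained_clustering (R : realType) (k n : nat)
    (w : 'I_n -> R) (kmin kmax : 'I_k -> R) : set 'M[R]_(k, n) :=
  [set xi | clustering xi /\
            forall i, kmin i <= \sum_j xi i j * w j <= kmax i].

Definition fully_assigned (R : realType) (k n : nat) (xi : 'M[R]_(k, n))
    (j : 'I_n) (i : 'I_k) : Prop := xi i j = 1.

Definition supp (R : realType) (d k n : nat) (x : 'I_n -> 'cV[R]_d)
    (xi : 'M[R]_(k, n)) (i : 'I_k) : set 'cV[R]_d :=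
  [set x j | j in [set j | 0 < xi i j]].

Record anisotropic_diagram (R : realType) (d k : nat) := AnisotropicDiagram {
  site : 'I_k -> 'cV[R]_d;
  size_param : 'I_k -> R;
  form : 'I_k -> 'M[R]_d;
  site_inj : injective site;
  form_posdef : forall i, sym_posdef (form i)
}.

Definition cell (R : realType) (d k : nat) (P : anisotropic_diagram R d k)
    (i : 'I_k) : set 'cV[R]_d :=
  [set z | forall l : 'I_k,
     sqnorm (form P i) (z - site P i) + size_param P i <=
     sqnorm (form P l) (z - site P l) + size_param P l].

Definition strongly_compatible (R : realType) (d k n : nat)
    (x : 'I_n -> 'cV[R]_d) (xi : 'M[R]_(k, n))
    (P : anisotropic_diagram R d k) : Prop :=
  forall i, supp x xi i = cell P i `&` range x.

Definition strictly_compatible (R : realType) (d k n : nat)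
    (x : 'I_n -> 'cV[R]_d) (xi : 'M[R]_(k, n))
    (P : anisotropic_diagram R d k) : Prop :=
  strongly_compatible x xi P /\
  forall i l : 'I_k, i != l ->
    is_subset1 (cell P i `&` cell P l `&` range x).

Definition is_line (R : realType) (d : nat) (L : set 'cV[R]_d) : Prop :=
  exists p u : 'cV[R]_d, u != 0 /\ L = [set p + s *: u | s in [set: R]].

Definition affine_set (R : realType) (d : nat) (A : set 'cV[R]_d) : Prop :=
  forall (a b : 'cV[R]_d) (s : R), A a -> A b -> A (s *: a + (1 - s) *: b).

Definition affine_hull (R : realType) (d : nat) (A : set 'cV[R]_d) :
    set 'cV[R]_d :=
  smallest (@affine_set R d) A.

Definition relative_interior (R : realType) (d : nat) (A : set 'cV[R]_d) :
    set 'cV[R]_d :=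
  [set a | A a /\ \forall b \near within (affine_hull A) (nbhs a), A b].

(* A one-dimensional convex set; it may be open, closed or half-open, and
   bounded or not. *)
Definition proper_interval (R : realType) (d : nat) (I : set 'cV[R]_d) : Prop :=
  convex_set I /\ is_line (affine_hull I).

(* Main.v *)
(** On a line, the distance functions of the diagram restrict to quadratic
    polynomials, and two of them cannot alternate [i l i l] at four increasing
    data positions: the third divided difference of a quadratic vanishes, so
    the two cells would share two data points. As for Davenport-Schinzel
    sequences of order 2, it then suffices to cut the line at the first and at
    the last data position of each cell, except for the first position of the
    cell met first and the last position of the cell met last: at most
    [2k - 2] cuts. Half-open pieces between the cuts have no cut in their
    relative interior. *)

Require Import Defs.
From mathcomp Require Import all_boot all_order all_algebra.
From mathcomp Require Import all_classical all_reals all_analysis.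
From mathcomp Require Import ring lra.

Set Implicit Arguments.
Unset Strict Implicit.
Unset Printing Implicit Defensive.

Import Order.TTheory GRing.Theory Num.Theory.
Import numFieldNormedType.Exports.

Local Open Scope classical_set_scope.
Local Open Scope ring_scope.

(** * Sign patterns of a quadratic *)

Lemma quadratic_alternation (R : realDomainType) (g : R -> R)
    (al be ga : R) (gE : forall s, g s = al * s ^+ 2 + be * s + ga)
    (a b c d : R) : a < b -> b < c -> c < d ->
  g a <= 0 -> 0 <= g b -> g c <= 0 -> 0 <= g d -> g a = 0 /\ g b = 0.
Proof.
move=> ab bc cd ga0 gb0 gc0 gd0.
(* The Vandermonde determinant of three nodes, positive on increasing ones. In [divdiff] it makes
   the left side nonnegative and the right side nonpositive, so every term vanishes. *)
pose V x y z : R := (y - x) * (z - x) * (z - y).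
have V_gt0 x y z : x < y -> y < z -> 0 < V x y z.
  by move=> xy yz; rewrite !mulr_gt0 ?subr_gt0 // (lt_trans xy).
(* A multiple of the third divided difference of [g]. *)
have divdiff : g b * V a c d + g d * V a b c = g a * V b c d + g c * V a b d.
  by rewrite !gE /V; ring.
have Va : 0 < V b c d by apply: V_gt0.
have Vb : 0 < V a c d by apply: V_gt0 => //; apply: lt_trans bc.
have Vc : 0 < V a b d by apply: V_gt0 => //; apply: lt_trans cd.
have Vd : 0 < V a b c by apply: V_gt0.
have ha : g a * V b c d <= 0 by rewrite pmulr_lle0.
have hb : 0 <= g b * V a c d by rewrite pmulr_lge0.
have hc : g c * V a b d <= 0 by rewrite pmulr_lle0.
have hd : 0 <= g d * V a b c by rewrite pmulr_lge0.
split.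
- have /eqP : g a * V b c d = 0 by lra.
  by rewrite mulf_eq0 (gt_eqF Va) orbF => /eqP.
- have /eqP : g b * V a c d = 0 by lra.
  by rewrite mulf_eq0 (gt_eqF Vb) orbF => /eqP.
Qed.

(** * Cuts that separate the cells *)

Lemma exists_argmin (disp : Order.disp_t) (V : orderType disp) (T : finType)
    (s : T -> V) (P : T -> Prop) :
  (exists j, P j) -> exists2 j, P j & forall j', P j' -> (s j <= s j')%O.
Proof.
case=> j0 Pj0; have Pb0 : `[< P j0 >] by apply/asboolP.
case: (Order.TotalTheory.arg_minP (P := fun j => `[< P j >]) s Pb0) => j /asboolP Pj minj.
by exists j => // j' Pj'; apply: minj; apply/asboolP.
Qed.

(** The combinatorial core, with membership in cells abstracted to [c]. Positions may repeat, and
    [a = b] is allowed in the conclusion, which then says that a data position off the cuts lies in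
    one cell only. *)
Lemma separating_points (R : realDomainType) (k : nat) (T : finType)
    (s : T -> R) (c : 'I_k -> T -> Prop)
    (c_cover : forall j, exists i, c i j)
    (c_ext : forall i a b, s a = s b -> c i a -> c i b)
    (c_once : forall i l a b,
       c i a -> c l a -> c i b -> c l b -> s a != s b -> i = l)
    (c_alt : forall i l a b a' b',
       s a < s b -> s b < s a' -> s a' < s b' ->
       c i a -> c l b -> c i a' -> c l b' -> i = l) :
  exists2 B : seq R, (size B <= 2 * k - 2)%N &
    forall a b i l, s a <= s b ->
      (forall t, t \in B -> ~~ (s a <= t <= s b)) ->
      c i a -> c l b -> i = l.
Proof.
have [[j0 _]|T0] := pselect (exists j : T, True); last first.
  by exists [::] => // a; case: T0; exists a.
have [jmin _ minP] : exists2 j, True & forall j', True -> s j <= s j'.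
  by apply: exists_argmin; exists j0.
have [jmax _ maxP] : exists2 j, True & forall j', True -> s j' <= s j.
  have [|j _ hj] := @exists_argmin _ R _ (fun j => - s j) (fun=> True).
    by exists j0.
  by exists j => // j' _; rewrite -lerN2; apply: hj.
have [i0 ci0] := c_cover jmin; have [i1 ci1] := c_cover jmax.
have /choice[fi fstP] : forall i, exists f, forall j, c i j ->
    c i f /\ s f <= s j.
  move=> i; have [exi|ni] := pselect (exists j, c i j).
    have [f cf hf] := @exists_argmin _ R _ s _ exi.
    by exists f => j cj; split => //; apply: hf.
  by exists j0 => j cj; case: ni; exists j.
have /choice[lst lstP] : forall i, exists f, forall j, c i j ->
    c i f /\ s j <= s f.
  move=> i; have [exi|ni] := pselect (exists j, c i j).
    have [f cf hf] := @exists_argmin _ R _ (fun j => - s j) _ exi.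
    by exists f => j cj; split => //; rewrite -lerN2; apply: hf.
  by exists j0 => j cj; case: ni; exists j.
(* Leaving out [i0] and [i1] gives [k - 1] cuts of each kind. A cell without data contributes an
   arbitrary, harmless position. *)
pose B := [seq s (fi i) | i in predC1 i0] ++ [seq s (lst i) | i in predC1 i1].
have fstB i : i != i0 -> s (fi i) \in B.
  by move=> ne; rewrite mem_cat; apply/orP; left; apply/mapP; exists i; rewrite ?mem_enum.
have lstB i : i != i1 -> s (lst i) \in B.
  by move=> ne; rewrite mem_cat; apply/orP; right; apply/mapP; exists i; rewrite ?mem_enum.
exists B.
  rewrite size_cat !size_image !cardC1 card_ord.
  by case: (k) => [|m]; rewrite ?mulnS //= mulSn mul1n addKn.
move=> a b i l ab sepB cia clb; apply/eqP/negPn/negP => /eqP ne.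
(* Otherwise the first position of [l'] lies between [a] and [b], so it is no cut and [l'] is [i0].
   Then [a] is leftmost, hence at the first position of [i'], which is a cut. *)
have fst_lt i' l' : i' <> l' -> c i' a -> c l' b -> s (fi l') < s a.
  move=> ne' ci' cl'; have [cf fb] := fstP _ _ cl'.
  rewrite ltNge; apply/negP => af.
  have l'0 : l' = i0.
    by apply/eqP/negPn/negP => /fstB /sepB; rewrite af fb.
  have [ci'f fi'a] := fstP _ _ ci'.
  have aE : s jmin = s a.
    apply/eqP; rewrite eq_le minP //= (le_trans af) //.
    by rewrite l'0; apply: (fstP _ _ ci0).2.
  have i'0 : i' != i0 by apply/eqP => e; apply: ne'; rewrite e l'0.
  have := sepB _ (fstB _ i'0).
  by rewrite (le_trans fi'a ab) andbT -aE minP.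
have lst_gt i' l' : i' <> l' -> c i' a -> c l' b -> s b < s (lst i').
  move=> ne' ci' cl'; have [cf af] := lstP _ _ ci'.
  rewrite ltNge; apply/negP => fb.
  have i'1 : i' = i1.
    by apply/eqP/negPn/negP => /lstB /sepB; rewrite af fb.
  have [cl'f bl'] := lstP _ _ cl'.
  have bE : s jmax = s b.
    apply/eqP; rewrite eq_le maxP //= andbT; apply: le_trans fb.
    by rewrite i'1; apply: (lstP _ _ ci1).2.
  have l'1 : l' != i1 by apply/eqP => e; apply: ne'; rewrite e i'1.
  have := sepB _ (lstB _ l'1).
  by rewrite (le_trans ab bl') /= -bE maxP.
have cfi := (fstP _ _ cia).1; have cfl := (fstP _ _ clb).1.
have cli := (lstP _ _ cia).1; have cll := (lstP _ _ clb).1.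
have := fst_lt _ _ ne cia clb; have := lst_gt _ _ ne cia clb => bi la.
(* If [s a < s b], the positions [fi l], [a], [b], [lst i] show the forbidden pattern [l i l i]. *)
move: ab; rewrite le_eqVlt => /orP[/eqP ab|ab]; last first.
  by apply: ne; apply/esym; apply: (c_alt _ _ _ _ _ _ la ab bi).
(* At a common position both cells contain [a], and both begin before it and end after it. The cell
   that begins first starts an alternation; if both begin together, they share two positions. *)
have cla : c l a by apply: c_ext clb.
have cib : c i b by apply: c_ext cia.
have nesym : l <> i by move=> e; apply: ne.
have ia := fst_lt _ _ nesym cla cib; have bl := lst_gt _ _ nesym cla cib.
case: (ltgtP (s (fi i)) (s (fi l))) => [il|li|e].
- by apply: ne; apply: (c_alt _ _ _ _ a (lst l) il) => //; rewrite ab.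
- by apply: ne; apply/esym; apply: (c_alt _ _ _ _ a (lst i) li) => //; rewrite ab.
- apply: ne; apply: (c_once _ _ (fi i) a) => //; last by rewrite lt_eqF.
  by apply: c_ext cfl.
Qed.

Lemma sqnorm_line (R : realType) (d : nat) (A : 'M[R]_d) (v u : 'cV[R]_d)
    (s : R) :
  sqnorm A (v + s *: u) =
  sqnorm A u * s ^+ 2 + ((u^T *m A *m v) 0 0 + (v^T *m A *m u) 0 0) * s
  + sqnorm A v.
Proof.
have trE : (v + s *: u)^T = v^T + s *: u^T by apply/matrixP => i j; rewrite !mxE.
rewrite /sqnorm trE !mulmxDl !mulmxDr -!scalemxAl -!scalemxAr.
rewrite !mxE; ring.
Qed.

(** * Half-open pieces of a line *)

Section LinePieces.
Variables (R : realType) (d : nat) (p u : 'cV[R]_d).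
Hypothesis u0 : u != 0.

(** The index of the piece containing [t]. Since a cut counts at its own position, it belongs to the
    piece on its right. *)
Definition rank_in (B : seq R) (t : R) : nat := count (fun b => b <= t) B.

Definition line_piece (B : seq R) (q : nat) : set 'cV[R]_d :=
  [set p + t *: u | t in [set t | rank_in B t = q]].

Lemma line_inj : injective (fun t : R => p + t *: u).
Proof.
move=> s t /addrI /eqP; rewrite -subr_eq0 -scalerBl scaler_eq0 (negbTE u0).
by rewrite orbF subr_eq0 => /eqP.
Qed.

Lemma line_combination r s t :
  r *: (p + s *: u) + (1 - r) *: (p + t *: u) = p + (r * s + (1 - r) * t) *: u.
Proof.
rewrite !scalerDr !scalerA addrACA -!scalerDl.
by rewrite [X in X *: p]addrC subrK scale1r.
Qed.

Lemma rank_in_mono B : {homo rank_in B : s t / s <= t >-> (s <= t)%N}.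
Proof. by move=> s t st; apply: sub_count => b /= bs; apply: le_trans st. Qed.

Lemma rank_in_lt B b s t :
  b \in B -> s < b -> b <= t -> (rank_in B s < rank_in B t)%N.
Proof.
move=> /perm_to_rem /permP BE sb bt; rewrite /rank_in !BE /= bt.
rewrite leNgt sb /= add0n add1n ltnS.
by apply: rank_in_mono; rewrite ltW // (lt_le_trans sb).
Qed.

(** Two distinct parameters in each piece make it one-dimensional. The bound [b <= s] carries the
    induction: points found beyond the head [c] count [c], which raises their rank by one. *)
Lemma path_rank_in b B q : path <%R b B -> (q <= size B)%N ->
  exists s t, [/\ b <= s, s < t, rank_in B s = q & rank_in B t = q].
Proof.
elim: B b q => [|c B IH] b q /=.
  by rewrite leqn0 => _ /eqP ->; exists b, (b + 1); split => //; rewrite ltrDl.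
move=> /andP[bc pB]; case: q => [_|q].
  have gtc e : e \in c :: B -> c <= e.
    rewrite inE => /predU1P[-> //|eB].
    by have /allP /(_ _ eB) /ltW := order_path_min lt_trans pB.
  have below s : s < c -> rank_in (c :: B) s = 0%N.
    move=> sc; apply/eqP; rewrite eqn0Ngt -has_count; apply/hasPn => e /gtc ce.
    by rewrite -ltNge (lt_le_trans sc).
  exists b, ((b + c) / 2).
  by split; [exact: lexx|lra|exact: below|apply: below; lra].
rewrite ltnS => /(IH _ _ pB)[s [t [cs st sq tq]]].
exists s, t; split => //; first by rewrite (le_trans _ cs) // ltW.
- by rewrite /rank_in /= cs -/(rank_in B s) sq.
- by rewrite /rank_in /= (le_trans cs (ltW st)) -/(rank_in B t) tq.
Qed.

Lemma sorted_rank_in B q : sorted <%R B -> (q <= size B)%N ->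
  exists s t, [/\ s < t, rank_in B s = q & rank_in B t = q].
Proof.
move=> sB qB.
have [b pB] : exists b, path <%R b B.
  by case: B sB {qB} => [|c B] /= pB; [exists 0|exists (c - 1); rewrite gtrDl ltrN10].
by have [s [t [_ st sq tq]]] := path_rank_in pB qB; exists s, t.
Qed.

Lemma line_piece_partition B : sorted <%R B ->
  classical_sets.partition [set: 'I_(size B).+1] (fun q => line_piece B q)
    [set p + s *: u | s in [set: R]].
Proof.
move=> sB; split.
- apply/seteqP; split => [z [q _ [s _ <-]]|z [s _ <-]]; first by exists s.
  have sq : (rank_in B s < (size B).+1)%N by rewrite ltnS count_size.
  by exists (Ordinal sq) => //; exists s.
- move=> i j _ _ [z [[s si <-] [t tj /line_inj ts]]].
  by apply/val_inj; rewrite /= -si -tj ts.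
- move=> q _; have [|s [_ [_ sq _]]] := @sorted_rank_in B q sB.
    by rewrite -ltnS.
  by exists (p + s *: u), s.
Qed.

(** By monotonicity, [rank_in B] is constant between two parameters of equal rank. *)
Lemma convex_line_piece B q : convex_set (line_piece B q).
Proof.
move=> y z l /set_mem[s sq <-] /set_mem[t tq <-]; apply/mem_set.
have l0 : 0 <= l%:num by [].
have l1 : l%:num <= 1 by [].
set r := l%:num in l0 l1.
exists (r * s + (1 - r) * t); last by rewrite -line_combination.
rewrite /=; wlog st : r s t sq tq l0 l1 / s <= t.
  move=> H; case/orP: (le_total s t) => st; first exact: H.
  rewrite addrC -[X in X * s](subKr 1); apply: H => //; lra.
have d0 : 0 <= t - s by rewrite subr_ge0.
have h1 : s <= r * s + (1 - r) * t by nra.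
have h2 : r * s + (1 - r) * t <= t by nra.
move: sq tq (rank_in_mono B h1) (rank_in_mono B h2) => /= -> -> ge_q le_q.
by apply/eqP; rewrite eqn_leq le_q.
Qed.

Lemma affine_hull_line_piece B q : sorted <%R B -> (q <= size B)%N ->
  affine_hull (line_piece B q) = [set p + s *: u | s in [set: R]].
Proof.
move=> sB qB; apply/seteqP; split.
  apply: smallest_sub => [|z [s _ <-]]; last by exists s.
  move=> y z r [s _ <-] [t _ <-]; exists (r * s + (1 - r) * t) => //.
  by rewrite line_combination.
move=> z [r _ <-] A [affA subA].
have [s [t [st sq tq]]] := sorted_rank_in sB qB.
(* The solution of [e * s + (1 - e) * t = r]. *)
pose e := (r - t) / (s - t).
have -> : p + r *: u = e *: (p + s *: u) + (1 - e) *: (p + t *: u).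
  rewrite line_combination; congr (_ + _ *: _).
  by rewrite /e; field; rewrite subr_eq0 lt_eqF.
by apply: affA; apply: subA; [exists s|exists t].
Qed.

Lemma near_line s (A : set 'cV[R]_d) : nbhs (p + s *: u) A ->
  exists2 e, 0 < e & A (p + (s - e) *: u).
Proof.
move=> /nbhs_ballP[e /= e0 eA].
(* Balls of matrices are entrywise, and [N] bounds every entry of [u]; a step of [e / (1 + N)] thus
   moves each coordinate by less than [e]. *)
pose N := \sum_i `|u i 0|.
have N0 : 0 <= N by apply: sumr_ge0.
have D0 : 0 < 1 + N by lra.
exists (e / (1 + N)); first by rewrite divr_gt0.
apply: eA; split => // i j; rewrite (ord1 j) /ball /= !mxE.
have -> : p i 0 + s * u i 0 - (p i 0 + (s - e / (1 + N)) * u i 0)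
          = e / (1 + N) * u i 0 by ring.
rewrite normrM (gtr0_norm (divr_gt0 e0 D0)) mulrAC ltr_pdivrMr //.
rewrite ltr_pM2l // (@le_lt_trans _ _ N) ?ltrDr //.
by rewrite /N (bigD1 i) //= lerDl sumr_ge0.
Qed.

(** A cut in a piece is its left end: points just before it are in the affine hull but have smaller
    rank. *)
Lemma relative_interior_line_piece B q s : sorted <%R B -> (q <= size B)%N ->
  relative_interior (line_piece B q) (p + s *: u) ->
  rank_in B s = q /\ s \notin B.
Proof.
move=> sB qB [[t tq /line_inj <-]]; rewrite /within /= => nearB.
split => //; apply/negP => tB.
have [e e0] := near_line nearB; rewrite affine_hull_line_piece //.
case=> [|r rq /line_inj rE]; first by exists (t - e).
have rt : r < t by rewrite rE gtrBl.
by have := rank_in_lt tB rt (lexx t); rewrite rq tq ltnn.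
Qed.

End LinePieces.

(** * Cells along a line, and clusters *)

Lemma cell_alternation (R : realType) (d k : nat)
    (P : anisotropic_diagram R d k) (p u : 'cV[R]_d) (i l : 'I_k)
    (a b a' b' : R) : a < b -> b < a' -> a' < b' ->
  cell P i (p + a *: u) -> cell P l (p + b *: u) ->
  cell P i (p + a' *: u) -> cell P l (p + b' *: u) ->
  cell P l (p + a *: u) /\ cell P i (p + b *: u).
Proof.
move=> ab ba' a'b' cia clb cia' clb'.
pose f h s := sqnorm (Defs.form P h) (p + s *: u - site P h) + size_param P h.
have fE h : exists al be ga, forall s, f h s = al * s ^+ 2 + be * s + ga.
  eexists _, _, _ => s.
  by rewrite /f addrAC sqnorm_line -addrA.
have [al [be [ga iE]]] := fE i; have [al' [be' [ga' lE]]] := fE l.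
have gE s : f i s - f l s = (al - al') * s ^+ 2 + (be - be') * s + (ga - ga').
  by rewrite iE lE; ring.
have [|||| ea eb] := quadratic_alternation gE ab ba' a'b'.
- by rewrite subr_le0; apply: cia.
- by rewrite subr_ge0; apply: clb.
- by rewrite subr_le0; apply: cia'.
- by rewrite subr_ge0; apply: clb'.
(* Where [f i] and [f l] agree, minimality of one is minimality of the other. *)
move: ea eb => /eqP; rewrite subr_eq0 => /eqP ea /eqP; rewrite subr_eq0 => /eqP eb.
split=> h; first by rewrite -/(f l a) -ea; apply: cia.
by rewrite -/(f i b) eb; apply: clb.
Qed.

Lemma clustering_support (R : realType) (k n : nat) (C : 'M[R]_(k, n)) j :
  clustering C -> exists i, 0 < C i j.
Proof.
move=> [C0 C1]; have [//|Cj] := pselect (exists i, 0 < C i j).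
have : \sum_i C i j = 0.
  apply: big1 => i _; apply/eqP; rewrite eq_le C0 andbT leNgt.
  by apply/negP => Cij; case: Cj; exists i.
by rewrite C1 => /eqP; rewrite oner_eq0.
Qed.

Lemma fully_assigned_unique (R : realType) (k n : nat) (C : 'M[R]_(k, n)) i j :
  clustering C -> (forall l, 0 < C l j -> l = i) -> fully_assigned C j i.
Proof.
move=> [C0 C1] uni; rewrite /fully_assigned -(C1 j) (bigD1 i) //= big1 ?addr0 //.
move=> l li; apply/eqP; rewrite eq_le C0 andbT leNgt.
by apply: contra li => /uni ->.
Qed.

(** * The partition of the line *)

Theorem theorem5p7 (R : realType) (d n k : nat) (hk : (0 < k)%N)
    (x : 'I_n -> 'cV[R]_d) (w : 'I_n -> R) (hw : forall j, 0 < w j)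
    (kmin kmax : 'I_k -> R) (C : 'M[R]_(k, n))
    (hC : constrained_clustering w kmin kmax C)
    (hP : exists P : anisotropic_diagram R d k, strictly_compatible x C P)
    (L : set 'cV[R]_d) (hL : is_line L) :
  exists (m : nat) (I : 'I_m -> set 'cV[R]_d),
    [/\ (m <= 2 * k - 1)%N,
        classical_sets.partition [set: 'I_m] I L,
        forall q, proper_interval (I q) &
        forall q, exists i : 'I_k, forall j : 'I_n,
          relative_interior (I q) (x j) -> fully_assigned C j i].
Proof.
have [P [compat once]] := hP; have [[C0 C1] _] := hC; have [p [u [u0 ->]]] := hL.
have CP i j : 0 < C i j -> cell P i (x j).
  move=> Cij; have /= : (supp x C i) (x j) by exists j.
  by rewrite compat => -[].
(* Only the indices of data points on the line matter; [s] will give their parameters. *)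
pose T := {j : 'I_n | `[< exists s, x j = p + s *: u >]}.
have /choice[s sE] : forall t : T, exists s, x (val t) = p + s *: u.
  by move=> t; exact: (asboolW (valP t)).
pose c i (t : T) := cell P i (x (val t)).
have c_cover t : exists i, c i t.
  have [i Ci] := clustering_support (val t) (conj C0 C1).
  by exists i; apply: CP.
have c_ext i a b : s a = s b -> c i a -> c i b by rewrite /c !sE => ->.
have c_once i l a b :
    c i a -> c l a -> c i b -> c l b -> s a != s b -> i = l.
  move=> cia cla cib clb /eqP sab; apply/eqP/negPn/negP => /once ile.
  apply: sab; apply: (@line_inj _ _ p u u0); rewrite /= -!sE.
  by apply: ile; split; [split| |split|]; rewrite //=; eexists.
have c_alt i l a b a' b' : s a < s b -> s b < s a' -> s a' < s b' ->
    c i a -> c l b -> c i a' -> c l b' -> i = l.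
  move=> ab ba' a'b' cia clb cia' clb'.
  have [cla cib] : c l a /\ c i b.
    by move: cia clb cia' clb'; rewrite /c !sE; apply: cell_alternation.
  by apply: (c_once _ _ a b) => //; rewrite lt_eqF.
have [B0 sizeB0 sepB0] := separating_points c_cover c_ext c_once c_alt.
pose B := sort <=%R (undup B0).
have memB : B =i B0 by move=> z; rewrite mem_sort mem_undup.
have sB : sorted <%R B by rewrite sort_lt_sorted undup_uniq.
(* There is one piece more than cuts; [hk] keeps the truncated subtractions in step. *)
have sizeB : ((size B).+1 <= 2 * k - 1)%N.
  have := leq_trans (size_undup B0) sizeB0; rewrite size_sort => /leq_ltn_trans.
  by apply; case: (k) hk => // k' _; rewrite mulnS addKn add2n subn1.
have sepB a b i l : s a \notin B -> s b \notin B ->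
    rank_in B (s a) = rank_in B (s b) -> c i a -> c l b -> i = l.
  wlog ab : a b i l / s a <= s b.
    move=> H aB bB rab cia clb; case/orP: (le_total (s a) (s b)) => ab.
      exact: (H a b).
    by apply/esym; apply: (H b a).
  (* A cut after [s a] and up to [s b] would raise the rank, and [s a] itself is not a cut. *)
  move=> aB bB rab; apply: sepB0 => // t; rewrite -memB => tB.
  apply/negP; rewrite le_eqVlt => /andP[/orP[/eqP at_|at_] tb].
    by move: aB; rewrite at_ tB.
  by have := rank_in_lt tB at_ tb; rewrite rab ltnn.
exists (size B).+1, (fun q => line_piece p u B q); split => //.
- exact: line_piece_partition.
- move=> q; have qB : (q <= size B)%N by rewrite -ltnS.
  split; first exact: convex_line_piece.
  by rewrite affine_hull_line_piece //; exists p, u.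
- move=> q; have qB : (q <= size B)%N by rewrite -ltnS.
  have onL j : relative_interior (line_piece p u B q) (x j) ->
      exists2 t : T, val t = j & rank_in B (s t) = q /\ s t \notin B.
    move=> rj; have [[r _ xr] _] := rj.
    have jT : `[< exists s, x j = p + s *: u >] by apply/asboolP; exists r.
    exists (exist _ j jT) => //.
    by apply: (relative_interior_line_piece (p := p) u0 sB qB); rewrite -sE.
  have [[j rj]|none] := pselect (exists j,
      relative_interior (line_piece p u B q) (x j)); last first.
    by exists (Ordinal hk) => j rj; case: none; exists j.
  (* Any cell of one interior data point serves: [sepB] makes it the only cell of every interior
     data point, so no other cluster has a share there. *)
  have [a _ [ra aB]] := onL j rj; have [i cia] := c_cover a.
  exists i => j' /onL[b bj' [rb bB]].
  apply: fully_assigned_unique => // l /CP; rewrite -bj' => clb.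
  by apply/esym; apply: (sepB a b) => //; rewrite ra.
Qed.
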